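(* Let $F(\boldsymbol{x})\in\Sigma^p[\boldsymbol{x}]$ be an SOS polynomial matrix in $n$ variables. For each $j\in\{1,\ldots,p\}$ let $\mathcal{A}^j := \mathbb{N}^n\cap \tfrac12\mathrm{New}(F(\boldsymbol{x})_{jj})$, where $F(\boldsymbol{x})_{jj}$ is the $j$-th diagonal entry of $F(\boldsymbol{x})$, and let $\boldsymbol{v}^{j}(\boldsymbol{x})$ be the column vector of the monomials $\{\boldsymbol{x}^{\boldsymbol{\alpha}} \mid \boldsymbol{\alpha}\in\mathcal{A}^j\}$. Then these monomial bases can be used without conservatism in the Gram representation of $F$; that is, there exists a positive semidefinite matrix $Q$ such that $$F(\boldsymbol{x})=\mathrm{diag}(\boldsymbol{v}^1(\boldsymbol{x}),\ldots,\boldsymbol{v}^p(\boldsymbol{x}))^{\intercal}\,Q\,\mathrm{diag}(\boldsymbol{v}^1(\boldsymbol{x}),\ldots,\boldsymbol{v}^p(\boldsymbol{x})).$$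
   Context: $\boldsymbol{x}=(x_1,\ldots,x_n)$ and $\boldsymbol{x}^{\boldsymbol{\alpha}}=\prod_i x_i^{\alpha_i}$ for $\boldsymbol{\alpha}\in\mathbb{N}^n$ (with $0\in\mathbb{N}$). A symmetric $p\times p$ real polynomial matrix $F(\boldsymbol{x})$ is an SOS matrix, written $F\in\Sigma^p[\boldsymbol{x}]$, if $F(\boldsymbol{x})=R(\boldsymbol{x})^{\intercal}R(\boldsymbol{x})$ for some $s$ and some $R\in\mathbb{R}[\boldsymbol{x}]^{s\times p}$. The support of a polynomial $f$ is the set of exponents $\boldsymbol{\alpha}$ whose coefficient in $f$ is nonzero, and its Newton polytope $\mathrm{New}(f)$ is the convex hull of its support. $\mathrm{diag}(\boldsymbol{v}^1,\ldots,\boldsymbol{v}^p)$ is the block-diagonal $(\sum_j|\mathcal{A}^j|)\times p$ matrix having the column vector $\boldsymbol{v}^j(\boldsymbol{x})$ at the $j$-th diagonal position and zeros elsewhere. *)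

(* Defs.v *)
From HB Require Import structures.
From mathcomp Require Import all_boot all_order all_algebra.
From mathcomp Require Import finmap mpoly.
From mathcomp Require Import boolp classical_sets cardinality reals.

Set Implicit Arguments.
Unset Strict Implicit.
Unset Printing Implicit Defensive.

Import Order.TTheory GRing.Theory Num.Theory.
Local Open Scope classical_set_scope.
Local Open Scope ring_scope.

Definition convex_hull (R : numDomainType) (V : lmodType R) (A : set V) :
    set V :=
  [set x | exists k (w : 'I_k -> R) (a : 'I_k -> V),
     [/\ forall i, 0 <= w i, \sum_i w i = 1, forall i, A (a i)
       & x = \sum_i w i *: a i]].

Definition psdmx (R : numDomainType) (m : nat) (Q : 'M[R]_m) : Prop :=
  Q^T = Q /\ forall u : 'cV[R]_m, 0 <= (u^T *m Q *m u) 0 0.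

(* The (\sum_j k j) x p matrix diag(v^1, ..., v^p): \mxdiag only builds square
   diagonal blocks, so the j-th horizontal strip is written as the k j x p
   matrix whose column j is v^j. *)
Definition diag_cols (S : nzRingType) (p : nat) (k : 'I_p -> nat)
    (v : forall j, 'cV[S]_(k j)) : 'M[S]_(\sum_j k j, p) :=
  \mxcol_(j < p) \matrix_(i < k j, l < p) (if l == j then v j i 0 else 0).

Section Newton.
Variables (R : realType) (n : nat).
Implicit Types (f : {mpoly R[n]}) (a : 'X_{1..n}).

Definition sos_mx (p : nat) (F : 'M[{mpoly R[n]}]_p) : Prop :=
  F^T = F /\
  exists (s : nat) (G : 'M[{mpoly R[n]}]_(s, p)), F = G^T *m G.

Definition exponent_vec a : 'rV[R]_n := \row_i (a i)%:R.

Definition newton_polytope f : set 'rV[R]_n :=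
  convex_hull (exponent_vec @` [set` msupp f]).

(* The multi-indices lying in (1/2) New(f). *)
Definition half_newton f : set 'X_{1..n} :=
  [set a | ( *:%R (2^-1) @` newton_polytope f) (exponent_vec a)].

Lemma finite_half_newton f : finite_set (half_newton f).
Proof.
pose N := (msize f).+1.
suff sub : half_newton f `<=` range (@bmnm n N).
  apply: sub_finite_set sub _; apply: finite_image; exact: finite_finset.
move=> a [y [k [w [b [w0 w1 bA ->]]]] /rowP ya].
have aE i : (a i)%:R = 2^-1 * \sum_j w j * (b j 0 i) :> R.
  by have := ya i; rewrite !mxE summxE => <-; congr (_ * _);
    apply: eq_bigr => j _; rewrite mxE.
have leb j : \sum_i b j 0 i <= (msize f)%:R.
  have [m /= mf <-] := bA j.
  under eq_bigr do rewrite mxE.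
  by rewrite -natr_sum ler_nat -mdegE; apply/ltnW/msize_mdeg_lt.
have mdaN : (mdeg a < N)%N.
  rewrite ltnS -(ler_nat R) mdegE natr_sum.
  under eq_bigr do rewrite aE.
  rewrite -mulr_sumr exchange_big /=.
  under eq_bigr do rewrite -mulr_sumr.
  have le1 : \sum_j w j * \sum_i b j 0 i <= (msize f)%:R.
    rewrite -[leRHS]mul1r -[X in X * _]w1 mulr_suml.
    by apply: ler_sum => j _; apply: ler_wpM2l.
  rewrite mulrC ler_pdivrMr ?ltr0n //; apply: (le_trans le1).
  by rewrite ler_peMr ?ler0n // ler1n.
by exists (BMultinom mdaN).
Qed.

(* fset_set is empty on infinite sets; finite_half_newton excludes that case. *)
Definition gram_exponents f : {fset 'X_{1..n}} := fset_set (half_newton f).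

Lemma gram_exponentsP f a :
  reflect (half_newton f a) (a \in gram_exponents f).
Proof.
rewrite in_fset_set; last exact: finite_half_newton.
by apply: (iffP idP); rewrite inE.
Qed.

Definition monomial_col (A : {fset 'X_{1..n}}) : 'cV[{mpoly R[n]}]_#|` A| :=
  \col_i 'X_[nth 0%MM A i].

End Newton.

(* Main.v *)
(** If [F = G^T G] then [F_jj] is the sum over [k] of [G_kj ^ 2].  Let [B] be
    the finite set of all exponents occurring in column [j] of [G], and reduce
    it to a set [E] of points, none in the convex hull of the others, with the
    same convex hull.  A point [e] of [E] is the midpoint of two points of [B]
    only trivially, so the coefficient of [x^(2e)] in [F_jj] is the sum over
    [k] of the squared coefficients of [x^e] in [G_kj], which is positive.
    Hence [2E] lies in the support of [F_jj] and [B] in half its Newton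
    polytope, so that [G] factors through the given monomial bases with a real
    coefficient matrix [H], and [Q = H^T H]. *)

Require Import Defs.
From HB Require Import structures.
From mathcomp Require Import all_boot all_order all_algebra.
From mathcomp Require Import finmap mpoly.
From mathcomp Require Import boolp classical_sets cardinality reals.

Set Implicit Arguments.
Unset Strict Implicit.
Unset Printing Implicit Defensive.

Import Order.TTheory GRing.Theory Num.Theory.

Local Open Scope ring_scope.

Section ConvexCombination.
Variables (R : realFieldType) (V : lmodType R).
Implicit Types (E : seq V) (c d e x : V).

(** Weights are indexed by points, not positions, so permuting [E] or removing a point needs no
    reindexing; a repeated point counts its weight each time. *)
Definition convex_comb E x : Prop :=
  exists w : V -> R, [/\ forall v, 0 <= w v, \sum_(v <- E) w v = 1
    & x = \sum_(v <- E) w v *: v].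

Lemma convex_comb_perm E E' x :
  perm_eq E E' -> convex_comb E x -> convex_comb E' x.
Proof.
by move=> EE' [w [w0 w1 ->]]; exists w; split=> //; rewrite -?w1; apply: perm_big;
  rewrite // perm_sym.
Qed.

Lemma convex_comb_mem E x : uniq E -> x \in E -> convex_comb E x.
Proof.
move=> uE xE; exists (fun v => (v == x)%:R); split=> [v||].
- exact: ler0n.
- rewrite (bigD1_seq x) //= eqxx big1 ?addr0 // => v /negPf ->//.
- rewrite (bigD1_seq x) //= eqxx scale1r big1 ?addr0 // => v /negPf ->.
  by rewrite scale0r.
Qed.

Lemma convex_comb_drop E e x :
  convex_comb E e -> convex_comb (e :: E) x -> convex_comb E x.
Proof.
move=> [u [u0 u1 eE]] [w [w0 w1 ->]].
(* The weight of [e] is redistributed over [E] in the proportions [u]. *)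
exists (fun v => w e * u v + w v); split=> [v||].
- by rewrite addr_ge0 ?mulr_ge0.
- by rewrite big_split /= -mulr_sumr u1 mulr1 -w1 big_cons.
- rewrite big_cons {2}eE scaler_sumr -big_split /=.
  by apply: eq_bigr => v _; rewrite scalerDl scalerA.
Qed.

(** Induction on the size: a point in the hull of the others is discarded, which by
    [convex_comb_drop] loses no convex combination. *)
Lemma convex_comb_independent E : exists E',
  [/\ {subset E' <= E}, forall x, convex_comb E x -> convex_comb E' x
    & forall e, e \in E' -> ~ convex_comb (rem e E') e].
Proof.
have [m] := ubnP (size E); elim: m E => // m IHm E; rewrite ltnS => sE.
have [[e [eE Ee]]|irrE] :=
  pselect (exists e, e \in E /\ convex_comb (rem e E) e); last first.
  by exists E; split=> // e eE Ee; apply: irrE; exists e.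
have [|E' [subE' E'conv irrE']] := IHm (rem e E).
  rewrite size_rem //; apply: leq_trans sE.
  by rewrite prednK //; case: (E) eE.
exists E'; split=> // [v /subE'/mem_rem //|x Ex].
apply: E'conv; apply: convex_comb_drop Ee _.
exact: convex_comb_perm (perm_to_rem eE) Ex.
Qed.

(** Let [W] and [U] be the weights that [c] and [d] put off [e]. Cancelling the share of [e] in
    [c + d = e + e] leaves [(W + U) *: e] as a combination of [E]. If [W + U] were nonzero, dividing
    by it would put [e] in the hull of [E]; so [W = 0]. *)
Lemma convex_comb_midpoint E e c d : ~ convex_comb E e ->
  convex_comb (e :: E) c -> convex_comb (e :: E) d -> c + d = e + e -> c = e.
Proof.
move=> irr [w [w0 + ->]] [u [u0 + ->]]; rewrite !big_cons.
set W := \sum_(v <- E) w v; set U := \sum_(v <- E) u v => w1 u1 cd.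
have W0 : 0 <= W by apply: sumr_ge0.
have U0 : 0 <= U by apply: sumr_ge0.
have weE : w e = 1 - W by rewrite -w1 addrK.
have ueE : u e = 1 - U by rewrite -u1 addrK.
have WUe : \sum_(v <- E) (w v + u v) *: v = (W + U) *: e.
  under eq_bigr do rewrite scalerDl.
  rewrite big_split /=; apply: (addrI ((w e + u e) *: e)).
  rewrite -[RHS]scalerDl [w e + u e + _]addrACA {2}weE {2}ueE !subrK.
  by rewrite [RHS]scalerDl !scale1r -cd scalerDl addrACA.
have [WU0|WU_neq0] := eqVneq (W + U) 0; last first.
  case: irr; exists (fun v => (W + U)^-1 * (w v + u v)); split=> [v||].
  - by rewrite mulr_ge0 ?invr_ge0 ?addr_ge0.
  - by rewrite -mulr_sumr big_split mulVf.
  - under eq_bigr do rewrite -scalerA.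
    by rewrite -scaler_sumr WUe scalerA mulVf ?scale1r.
have W_0 : W = 0 by apply/eqP; move/eqP: WU0; rewrite paddr_eq0 // => /andP[].
rewrite weE W_0 subr0 scale1r big_seq big1 ?addr0 // => v vE.
suff -> : w v = 0 by rewrite scale0r.
apply/eqP; move/eqP: W_0; rewrite /W psumr_eq0 // => /allP /(_ v vE).
by [].
Qed.

End ConvexCombination.

Section Newton.
Variables (R : realType) (n : nat).
Implicit Types (f : {mpoly R[n]}) (a b : 'X_{1..n}).

Lemma exponent_vecD a b :
  exponent_vec R (a + b)%MM = exponent_vec R a + exponent_vec R b.
Proof. by apply/rowP => i; rewrite !mxE mnmDE natrD. Qed.

Lemma exponent_vec_inj : injective (@exponent_vec R n).
Proof.
move=> a b /rowP ab; apply/mnmP => i.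
by have /eqP := ab i; rewrite !mxE eqr_nat => /eqP.
Qed.

Lemma convex_comb_half_newton (E : seq 'rV[R]_n) f a :
  (forall e, e \in E -> exists2 b, b \in msupp f & exponent_vec R b = e + e) ->
  convex_comb E (exponent_vec R a) -> half_newton f a.
Proof.
move=> Ef [w [w0 w1 aE]].
exists (2 *: exponent_vec R a) => /=; last first.
  by rewrite scalerA mulVf ?scale1r // pnatr_eq0.
exists (size E), (fun i => w E`_i), (fun i => E`_i + E`_i); split=> //.
- by rewrite -w1 (big_nth 0) big_mkord.
- by move=> i; have [b bf bE] := Ef _ (mem_nth 0 (ltn_ord i)); exists b.
- rewrite aE (big_nth 0) big_mkord scaler_sumr; apply: eq_bigr => i _.
  by rewrite scalerA mulrC -scalerA scaler_nat mulr2n.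
Qed.

Lemma mcoeff_sum_sqr s (g : 'I_s -> {mpoly R[n]}) b :
  (forall k c d, c \in msupp (g k) -> d \in msupp (g k) ->
    (c + d = b + b)%MM -> c = b) ->
  (\sum_k g k * g k)@_(b + b) = \sum_k (g k)@_b ^+ 2.
Proof.
move=> bP; rewrite raddf_sum /=; apply: eq_bigr => k _; rewrite mcoeffM.
(* [mcoeffM] sums over pairs of degree-bounded exponents; this bound makes [(b, b)] one of them, and
   [bP] kills all others. *)
have bb : (mdeg b < (mdeg (b + b)%MM).+1)%N by rewrite ltnS mdegD leq_addr.
rewrite (bigD1 (BMultinom bb, BMultinom bb)) //= big1 ?addr0 ?expr2 //.
move=> [c d] /= /andP[/eqP bbE]; apply: contraNeq.
rewrite mulf_eq0 negb_or -!mcoeff_msupp => /andP[cg dg].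
have cb : c = b :> 'X_{1..n} by apply: bP cg dg _.
have db : d = b :> 'X_{1..n} by apply: bP dg cg _; rewrite addmC.
by apply/eqP; congr pair; apply: val_inj.
Qed.

Lemma msupp_half_newton s (g : 'I_s -> {mpoly R[n]}) k a :
  a \in msupp (g k) -> half_newton (\sum_k g k * g k) a.
Proof.
(* Duplicates are removed because [convex_comb_mem] puts weight 1 on a point that must occur only
   once. *)
set B := undup [seq exponent_vec R b | b <- flatten [seq msupp (g k) | k : 'I_s]].
have gB l b : b \in msupp (g l) -> exponent_vec R b \in B.
  move=> bg; rewrite mem_undup map_f //; apply/flattenP.
  by exists (msupp (g l)) => //; apply: map_f; rewrite mem_enum.
have [E [EB Econv irrE]] := convex_comb_independent B.
have Bconv l b : b \in msupp (g l) -> convex_comb E (exponent_vec R b).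
  by move=> /gB bB; apply/Econv/convex_comb_mem => //; apply: undup_uniq.
move=> /Bconv; apply: convex_comb_half_newton => e eE.
have := EB _ eE; rewrite mem_undup => /mapP[b bg eb].
have {bg} [l bg] : exists l, b \in msupp (g l).
  by move/flattenP: bg => [_ /mapP[l _ ->]]; exists l.
exists (b + b)%MM; last by rewrite exponent_vecD -eb.
rewrite mcoeff_msupp mcoeff_sum_sqr; last first.
  move=> l' c d cg dg cd; apply: exponent_vec_inj; rewrite -eb.
  have peE := perm_to_rem eE.
  apply: (@convex_comb_midpoint _ _ (rem e E) e _ (exponent_vec R d)).
  - exact: irrE.
  - exact: convex_comb_perm peE (Bconv _ _ cg).
  - exact: convex_comb_perm peE (Bconv _ _ dg).
  - by rewrite -exponent_vecD cd exponent_vecD eb.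
(* A vanishing sum of squares would force the coefficient of [b] in [g l] to vanish. *)
apply/negP; rewrite psumr_eq0 => [/allP/(_ l)|k' _]; last exact: sqr_ge0.
by move: bg; rewrite mcoeff_msupp mem_index_enum sqrf_eq0 => /negPf -> /(_ isT).
Qed.

Lemma mpoly_monomial_col f (A : {fset 'X_{1..n}}) : {subset msupp f <= A} ->
  f = \sum_(i < #|` A|) (f@_(nth 0%MM A i))%:MP * monomial_col R A i 0.
Proof.
move=> fA; under eq_bigr do rewrite mxE mul_mpolyC.
rewrite -(big_mkord xpredT (fun i => f@_(nth 0%MM A i) *: 'X_[nth 0%MM A i])).
rewrite -(big_nth 0%MM xpredT (fun a => f@_a *: 'X_[a])).
apply/mpolyP => a; rewrite raddf_sum /=.
under eq_bigr do rewrite mcoeffZ mcoeffX.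
have [aA|aA] := boolP (a \in A).
  rewrite (bigD1_seq a) ?fset_uniq //= eqxx mulr1 big1 ?addr0 // => b /negPf ->.
  by rewrite mulr0.
rewrite big_seq big1 => [|b bA]; last first.
  by rewrite (_ : b == a = false) ?mulr0 //; apply: contraNF aA => /eqP <-.
by apply/eqP; rewrite mcoeff_eq0; apply: contraNN aA => /fA.
Qed.

End Newton.

Lemma psdmx_gram (R : realDomainType) s m (H : 'M[R]_(s, m)) : psdmx (H^T *m H).
Proof.
split=> [|u]; first by rewrite trmx_mul trmxK.
rewrite mulmxA -mulmxA -trmx_mul mxE; apply: sumr_ge0 => i _.
by rewrite mxE -expr2 sqr_ge0.
Qed.

Theorem theorem3p2 (R : realType) (n p : nat) (F : 'M[{mpoly R[n]}]_p)
    (hF : sos_mx F) :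
  let A := fun j : 'I_p => gram_exponents (F j j) in
  let V := diag_cols (fun j : 'I_p => monomial_col R (A j)) in
  exists2 Q : 'M[R]_(\sum_(j < p) #|` A j|),
    psdmx Q & F = V^T *m map_mx (@mpolyC n R) Q *m V.
Proof.
move=> A V; have [_ [s [G FG]]] := hF.
have GA k j : {subset msupp (G k j) <= A j}.
  move=> a aG; apply/gram_exponentsP.
  have -> : F j j = \sum_l G l j * G l j.
    by rewrite FG mxE; apply: eq_bigr => l _; rewrite mxE.
  exact: (@msupp_half_newton _ _ _ (G^~ j) k).
(* Block [j] of [H] holds the coordinates of column [j] of [G] in the basis [A j]. *)
pose H := \mxrow_(j < p) \matrix_(k < s, i < #|` A j|) (G k j)@_(nth 0%MM (A j) i).
have GH : G = map_mx (@mpolyC n R) H *m V.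
  have -> : map_mx (@mpolyC n R) H = \mxrow_(j < p)
      \matrix_(k < s, i < #|` A j|) ((G k j)@_(nth 0%MM (A j) i))%:MP.
    by apply/matrixP => k i; rewrite !mxE.
  rewrite /V /diag_cols mul_mxrow_mxcol; apply/matrixP => k j.
  (* Column [j] of [V] is zero outside strip [j]. *)
  rewrite summxE (bigD1 j) //= [X in _ + X]big1 => [|l lj]; last first.
    by rewrite mxE big1 // => i _; rewrite !mxE eq_sym (negPf lj) mulr0.
  rewrite addr0 mxE [LHS](mpoly_monomial_col (GA k j)).
  by apply: eq_bigr => i _; rewrite !mxE eqxx.
exists (H^T *m H); first exact: psdmx_gram.
by rewrite map_mxM -map_trmx mulmxA -trmx_mul -mulmxA -GH.
Qed.
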